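(* Let $d\geq 2$. There exists a probability measure $\rho$ on the closed unit ball $B_{\mathbb{R}^d}(0,1)$, absolutely continuous with respect to the Lebesgue measure and with density bounded below by a positive constant on $B_{\mathbb{R}^d}(0,1)$, such that for every $R>0$, every $C>0$, every $\alpha>0$ and every real $p\geq 1$, setting $\mathcal{Y}=B_{\mathbb{R}^d}(0,R)$, the inequality $$\forall \mu,\nu\in\mathcal{P}(\mathcal{Y}),\qquad \|T_\mu-T_\nu\|_{L^2(\rho)}\leq C\, W_p(\mu,\nu)^{\alpha}$$ fails (i.e. there exist $\mu,\nu\in\mathcal{P}(\mathcal{Y})$ with $\|T_\mu-T_\nu\|_{L^2(\rho)}> C\, W_p(\mu,\nu)^{\alpha}$).
   Context: $B_{\mathbb{R}^d}(0,R)$ denotes the closed Euclidean ball of radius $R$ centered at $0$ in $\mathbb{R}^d$. For $\mathcal{X}\subset\mathbb{R}^d$, $\mathcal{P}(\mathcal{X})$ denotes the set of Borel probability measures on $\mathcal{X}$ (viewed as probability measures on $\mathbb{R}^d$ concentrated on $\mathcal{X}$). $\mathcal{P}_2(\mathbb{R}^d)$ is the set of probability measures on $\mathbb{R}^d$ with finite second moment. $W_p$ denotes the $p$-Wasserstein distance with respect to the Euclidean distance: $W_p(\mu,\nu)^p=\inf_\gamma\int |x-y|^p\,\mathrm{d}\gamma(x,y)$, the infimum being over couplings $\gamma$ of $\mu$ and $\nu$. Given $\rho,\mu\in\mathcal{P}_2(\mathbb{R}^d)$ with $\rho$ absolutely continuous with respect to the Lebesgue measure, $T_\mu\in L^2(\rho)=L^2(\rho;\mathbb{R}^d)$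 denotes the optimal transport map (Brenier map) from $\rho$ to $\mu$ for the quadratic cost, i.e. the $\rho$-a.e. unique minimizer of $\int |x-T(x)|^2\,\mathrm{d}\rho(x)$ among measurable maps $T:\mathbb{R}^d\to\mathbb{R}^d$ with $T_\#\rho=\mu$; its existence and $\rho$-a.e. uniqueness are given by Brenier's theorem. The norm is $\|T_\mu-T_\nu\|_{L^2(\rho)}=\left(\int |T_\mu(x)-T_\nu(x)|^2\,\mathrm{d}\rho(x)\right)^{1/2}$. *)

(* Defs.v *)
From HB Require Import structures.
From mathcomp Require Import all_boot all_order all_algebra.
From mathcomp Require Import all_classical all_reals all_analysis.
Set Implicit Arguments.
Unset Strict Implicit.
Unset Printing Implicit Defensive.
Import Order.TTheory GRing.Theory Num.Theory.
Import numFieldNormedType.Exports.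
Local Open Scope classical_set_scope.
Local Open Scope ring_scope.

(* The library equips tuples with the product sigma-algebra, which for real
   coordinates is the Borel sigma-algebra of R^d. *)
Notation Rn R d := (d.-tuple (measurableTypeR R)).

Section Euclidean.
Context (R : realType) (d : nat).

Definition enorm (x : Rn R d) : R :=
  Num.sqrt (\sum_(i < d) (tnth x i : R) ^+ 2).

Definition edist (x y : Rn R d) : R :=
  Num.sqrt (\sum_(i < d) ((tnth x i : R) - (tnth y i : R)) ^+ 2).

Definition cball (r : R) : set (Rn R d) := [set x | enorm x <= r].

End Euclidean.
Arguments cball : clear implicits.

Section Lebesgue.
Context (R : realType).

Definition cons_pair n (z : measurableTypeR R * Rn R n) : Rn R n.+1 :=
  [tuple of z.1 :: z.2].

Lemma measurable_cons_pair n : measurable_fun [set: _] (@cons_pair n).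
Proof. exact: measurable_cons. Qed.

Section cons.
Context n (m : {sigma_finite_measure set (Rn R n) -> \bar R}).

Definition lebesgue_cons : set (Rn R n.+1) -> \bar R :=
  pushforward (@lebesgue_measure R \x m)%E (@cons_pair n).

Let mcons := @measurable_cons_pair n.

Let lebesgue_cons0 : lebesgue_cons set0 = 0%E.
Proof. exact: measure0. Qed.

Let lebesgue_cons_ge0 A : (0 <= lebesgue_cons A)%E.
Proof. exact: measure_ge0. Qed.

Let lebesgue_cons_sigma_additive : semi_sigma_additive lebesgue_cons.
Proof. exact: measure_semi_sigma_additive. Qed.

HB.instance Definition _ := isMeasure.Build _ _ _ lebesgue_cons
  lebesgue_cons0 lebesgue_cons_ge0 lebesgue_cons_sigma_additive.

Let lebesgue_cons_sigma_finite : sigma_finite setT lebesgue_cons.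
Proof.
have /sigma_finiteP[F [UF ndF mF]] := sigma_finiteT (@lebesgue_measure R).
have /sigma_finiteP[G [UG ndG mG]] := sigma_finiteT m.
pose psi (t : Rn R n.+1) : measurableTypeR R * Rn R n :=
  (thead t, [tuple of behead t]).
have mpsi : measurable_fun setT psi.
  apply: measurable_fun_pair; first exact: measurable_tnth.
  exact: measurable_behead.
have psiK : cancel (@cons_pair n) psi.
  by move=> [x t]; congr pair; apply: val_inj.
exists (fun i => psi @^-1` (F i `*` G i)).
  apply/seteqP; split => // t _.
  have [i _ Fi] : (\bigcup_i F i) (psi t).1 by rewrite -UF.
  have [j _ Gj] : (\bigcup_i G i) (psi t).2 by rewrite -UG.
  exists (maxn i j) => //; split.
    by move: Fi; exact/subsetPset/ndF/leq_maxl.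
  by move: Gj; exact/subsetPset/ndG/leq_maxr.
move=> i; have [mFi Foo] := mF i; have [mGi Goo] := mG i; split.
  by rewrite -[X in measurable X]setTI; apply: mpsi => //; exact: measurableX.
rewrite /lebesgue_cons /pushforward (_ : _ @^-1` _ = F i `*` G i).
  by rewrite product_measure1E// lte_mul_pinfty// ge0_fin_numE.
by rewrite -comp_preimage (_ : psi \o _ = id)//; apply/funext => z; exact: psiK.
Qed.

HB.instance Definition _ :=
  Measure_isSigmaFinite.Build _ _ _ lebesgue_cons lebesgue_cons_sigma_finite.

End cons.

(* Lebesgue measure on the Borel sets of R^n, as an iterated product of the
   one-dimensional Lebesgue measure; [lebesgue_box] characterizes it. *)
Fixpoint lebesgue n : {sigma_finite_measure set (Rn R n) -> \bar R} :=
  match n with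
  | 0%N => (dirac ([tuple] : Rn R 0))
  | n'.+1 => (lebesgue_cons (lebesgue n'))
  end.

Lemma lebesgue_box n (A : 'I_n -> set (measurableTypeR R)) :
  (forall i, measurable (A i)) ->
  lebesgue n [set x | forall i, A i (tnth x i)] =
  (\prod_(i < n) lebesgue_measure (A i))%E.
Proof.
elim: n A => [|n IHn] A mA.
  by rewrite big_ord0 /= diracE mem_set// => -[].
rewrite big_ord_recl -IHn; last by move=> i.
rewrite -product_measure1E//; last first.
  rewrite (_ : [set x | _] = \bigcap_(i in [set: 'I_n])
      ((@tnth _ _ ^~ i) @^-1` A (lift ord0 i))); last first.
    by apply/seteqP; split => x /= Ax i; [move=> _; exact: Ax|exact: (Ax i)].
  apply: fin_bigcap_measurable; first exact: finite_finset.
  by move=> i _; rewrite -[X in measurable X]setTI; exact: measurable_tnth.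
congr (product_measure1 _ _ _); apply/seteqP; split => -[a t]/=.
  move=> Aat; split; first exact: (Aat ord0).
  by move=> i; have := Aat (lift ord0 i); rewrite tnthS.
move=> [Aa At] i; case: (unliftP ord0 i) => [j|] ->; last exact: Aa.
by rewrite tnthS; exact: At.
Qed.

End Lebesgue.

Section Transport.
Context (R : realType) (d : nat).
Implicit Types (rho mu nu : probability (Rn R d) R) (T : Rn R d -> Rn R d).

Definition supported_on mu (A : set (Rn R d)) := mu A = 1%E.

Definition has_density rho (f : Rn R d -> R) :=
  [/\ measurable_fun setT f, forall x, 0 <= f x &
      forall A, measurable A ->
        rho A = (\int[lebesgue R d]_(x in A) (f x)%:E)%E].

Definition coupling mu nu (g : probability (Rn R d * Rn R d)%type R) :=
  (forall A, measurable A -> pushforward g fst A = mu A) /\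
  (forall A, measurable A -> pushforward g snd A = nu A).

Definition wasserstein (p : R) mu nu : \bar R :=
  (ereal_inf [set \int[g]_z ((edist z.1 z.2) `^ p)%:E
             | g in coupling mu nu] `^ p^-1)%E.

Definition transport_map rho mu T :=
  measurable_fun setT T /\
  forall A, measurable A -> pushforward rho T A = mu A.

Definition quadratic_cost rho T : \bar R :=
  (\int[rho]_x (edist x (T x) ^+ 2)%:E)%E.

Definition optimal_map rho mu T :=
  transport_map rho mu T /\
  forall T', transport_map rho mu T' ->
    (quadratic_cost rho T <= quadratic_cost rho T')%E.

(* The minimizer is required to be rho-a.e. unique, so that quantities such as
   [L2dist] do not depend on which Brenier map is picked. *)
Definition brenier_map rho mu T :=
  optimal_map rho mu T /\
  forall T', optimal_map rho mu T' -> {ae rho, forall x, T' x = T x}.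

Definition L2dist rho T S : \bar R :=
  Lnorm rho 2%:E (fun x => (edist (T x) (S x))%:E).

End Transport.

(* Main.v *)
Require Import Defs.
From HB Require Import structures.
From mathcomp Require Import all_boot all_order all_algebra.
From mathcomp Require Import all_classical all_reals all_analysis.
From mathcomp Require Import measurable_realfun ring lra.
Import Order.TTheory GRing.Theory Num.Theory.
Import numFieldNormedType.Exports.
Local Open Scope classical_set_scope.
Local Open Scope ring_scope.

(* For a law [rho] symmetric about the origin and a target carried with equal
   masses by two opposite points y and -y, the Brenier map sends x to the nearer
   of the two: T x = y on the half-space {x.y > 0} and -y elsewhere. Tilting y by
   an angle t moves the target by about t in every W_p, but changes the map by a
   constant amount on the wedge between the two half-spaces, so the squared L^2
   distance is of the order of the mass of that wedge. It therefore suffices that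
   [rho] gives the slabs {|x_0| <= t} a mass decaying slower than every power of
   t: the density below is a sum of slab indicators, slab k having width
   2^-(k^2) and mass of order 2^-k, added to the indicator of the ball. *)

(* MathComp-Analysis has its own [edist], which would otherwise be meant here. *)
Local Notation edist := Defs.edist.

(** * Probability measures given by a density *)

Section DensityProbability.
Context {disp : measure_display} {T : measurableType disp} {R : realType}.

Lemma probability_of_density (mu : {measure set T -> \bar R}) (f : T -> R) :
  measurable_fun setT f -> (forall x, 0 <= f x) ->
  (\int[mu]_x (f x)%:E = 1)%E ->
  exists P : probability T R, forall A, measurable A ->
    P A = (\int[mu]_(x in A) (f x)%:E)%E.
Proof.
move=> mf f0 f1.
pose m (A : set T) := (\int[mu]_(x in A) (f x)%:E)%E.
have m0 : m set0 = 0%E by exact: integral_set0.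
have m_ge0 A : (0 <= m A)%E by apply: integral_ge0 => x _; rewrite lee_fin.
have m_add : semi_sigma_additive m.
  by apply: semi_sigma_additive_nng_induced => //; exact/measurable_EFinP.
pose mm := isMeasure.Build _ _ _ m m0 m_ge0 m_add.
pose M : {measure set T -> \bar R} := HB.pack m mm.
have M1 : M setT = 1%E by [].
pose pm := Measure_isProbability.Build _ _ _ M M1.
pose P : probability T R := HB.pack m mm pm.
by exists P.
Qed.

End DensityProbability.

(** * Inner product and reflection through the origin *)

Section Coordinates.
Context {R : realType} {n : nat}.
Implicit Types x y : Rn R n.

Definition dot x y : R := \sum_(i < n) (tnth x i : R) * (tnth y i : R).

Definition neg x : Rn R n := [tuple (- (tnth x i : R)) | i < n].

Lemma tnth_neg x i : tnth (neg x) i = - (tnth x i : R).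
Proof. by rewrite tnth_mktuple. Qed.

Lemma dotNl x y : dot (neg x) y = - dot x y.
Proof. by rewrite /dot -sumrN; apply: eq_bigr => i _; rewrite tnth_neg mulNr. Qed.

Lemma measurable_coord (i : 'I_n) :
  measurable_fun setT (fun x : Rn R n => tnth x i : R).
Proof. exact: measurable_tnth. Qed.

Lemma measurable_neg : measurable_fun setT neg.
Proof.
apply/measurable_fun_tnthP => i /=.
rewrite (_ : _ \o _ = (fun x => - (tnth x i : R))); last first.
  by apply/funext => x /=; rewrite tnth_neg.
by apply: measurableT_comp => //; exact: measurable_coord.
Qed.

Lemma measurable_dot y : measurable_fun setT (dot ^~ y).
Proof.
apply: measurable_sum => i.
by apply: measurable_funM => //; exact: measurable_coord.
Qed.

End Coordinates.

Lemma dot_recl {R : realType} {n} (x y : Rn R n.+1) : dot x y =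
  (thead x : R) * (thead y : R)
    + dot [tuple of behead x] [tuple of behead y].
Proof.
rewrite /dot big_ord_recl; congr (_ + _); apply: eq_bigr => i _.
rewrite !tnth_behead (_ : inord i.+1 = lift ord0 i)//.
by apply: val_inj; rewrite /= inordK ?ltnS.
Qed.

(** * Lebesgue measure: reflection and hyperplanes *)

Section LebesgueRn.
Context {R : realType}.

(** Induction on the dimension: the section of the reflected set at [a] is the reflection of the
    section of [A] at [-a], so the induction hypothesis and the symmetry of the measure on the line
    combine. *)
Lemma lebesgueN n (A : set (Rn R n)) : measurable A ->
  lebesgue R n (neg @^-1` A) = lebesgue R n A.
Proof.
elim: n A => [|n IHn] A mA.
  rewrite (_ : neg @^-1` A = A)//; apply/funext => x /=.
  by rewrite (tuple0 (neg x)) (tuple0 x).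
have mB : measurable (@cons_pair R n @^-1` A).
  by rewrite -[X in measurable X]setTI; exact: measurable_cons_pair.
rewrite /= /lebesgue_cons /pushforward /product_measure1 /=.
set B := _ @^-1` A in mB *.
pose h a := lebesgue R n (xsection B a).
have mh : measurable_fun setT h by exact: measurable_fun_xsection.
transitivity (\int[@lebesgue_measure R]_a h (- a)%R)%E.
  apply: eq_integral => a _; rewrite /h /= -[RHS]IHn; last first.
    exact: measurable_xsection.
  have negE t : neg (cons_pair (a, t)) = cons_pair (- a, neg t).
    apply: eq_from_tnth => i; rewrite tnth_neg.
    by case: (unliftP ord0 i) => [j|] ->; rewrite ?tnthS ?tnth_neg.
  congr (lebesgue R n _); apply/funext => t; rewrite /xsection /= /B /=.
  by apply/propext; rewrite !inE /= negE.
have mN : measurable_fun setT (-%R : measurableTypeR R -> measurableTypeR R).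
  exact: oppr_measurable.
rewrite -[LHS](_ : \int[pushforward (@lebesgue_measure R)
  (-%R : measurableTypeR R -> measurableTypeR R)]_a h a = _)%E; last first.
  by rewrite ge0_integral_pushforward ?preimage_setT// => a _; exact: measure_ge0.
by apply: eq_measure_integral => // C mC _; exact: lebesgue_measureN.
Qed.

(** Fubini with the first coordinate integrated innermost. [lebesgue] is built from the other order
    of integration, but both product measures agree on rectangles, hence on all measurable sets. *)
Lemma lebesgue_sections0 n (A : set (Rn R n.+1)) : measurable A ->
  (forall t : Rn R n,
    lebesgue_measure [set a : measurableTypeR R | A (cons_pair (a, t))] = 0%E) ->
  lebesgue R n.+1 A = 0%E.
Proof.
move=> mA A0.
have mB : measurable (@cons_pair R n @^-1` A).
  by rewrite -[X in measurable X]setTI; exact: measurable_cons_pair.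
rewrite /= /lebesgue_cons /pushforward.
have m2E (C : set (measurableTypeR R)) (D : set (Rn R n)) :
    measurable C -> measurable D ->
    product_measure2 (@lebesgue_measure R) (lebesgue R n) (C `*` D) =
      (lebesgue_measure C * lebesgue R n D)%E.
  by move=> mC mD; exact: product_measure2E.
rewrite (product_measure_unique m2E mB).
apply: integral0_eq => t _ /=; rewrite -[RHS](A0 t).
congr lebesgue_measure; apply/funext => a.
by rewrite /ysection /=; apply/propext; rewrite inE.
Qed.

(** Each line parallel to the first axis meets the hyperplane in a single point. *)
Lemma lebesgue_hyperplane n (y : Rn R n.+1) : (thead y : R) != 0 ->
  lebesgue R n.+1 [set x | dot x y = 0] = 0%E.
Proof.
move=> y0; apply: lebesgue_sections0 => [|t].
  rewrite -[X in measurable X]setTI.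
  by apply: (measurable_dot y measurableT [set 0]); exact: measurable_set1.
rewrite (_ : [set a | _] =
  [set - dot t [tuple of behead y] / (thead y : R)]) ?lebesgue_measure_set1//.
have tE a : dot (cons_pair (a, t)) y =
    a * (thead y : R) + dot t [tuple of behead y].
  by rewrite dot_recl theadE; congr (_ + dot _ _); exact: val_inj.
apply/seteqP; split => a /=; rewrite tE.
  by move/eqP; rewrite addr_eq0 => /eqP /(canRL (mulfK y0)).
by move->; rewrite divfK// addNr.
Qed.

End LebesgueRn.

(** * Optimal transport onto two opposite points *)

Section TwoPointTransport.
Context {R : realType} {n : nat}.
Implicit Types (x y z : Rn R n) (rho mu nu : probability (Rn R n) R).

Lemma edist_sqr x y :
  edist x y ^+ 2 = \sum_(i < n) ((tnth x i : R) - (tnth y i : R)) ^+ 2.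
Proof. by rewrite sqr_sqrtr// sumr_ge0// => i _; exact: sqr_ge0. Qed.

Lemma edist_ge0 x y : 0 <= edist x y.
Proof. exact: sqrtr_ge0. Qed.

Lemma edist_sqr_neg x y :
  edist x (neg y) ^+ 2 = edist x y ^+ 2 + 4 * dot x y.
Proof.
rewrite !edist_sqr /dot mulr_sumr -big_split /=.
by apply: eq_bigr => i _; rewrite tnth_neg; ring.
Qed.

Lemma edist_negneg y z : edist (neg y) (neg z) = edist y z.
Proof.
congr Num.sqrt; apply: eq_bigr => i _.
by rewrite !tnth_neg -opprD sqrrN.
Qed.

Lemma measurable_edist {disp} {U : measurableType disp} (f g : U -> Rn R n) :
  measurable_fun setT f -> measurable_fun setT g ->
  measurable_fun setT (fun u => edist (f u) (g u)).
Proof.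
move=> mf mg; apply: measurableT_comp.
  by apply: continuous_measurable_fun; exact: sqrt_continuous.
apply: measurable_sum => i; apply: measurable_funX; apply: measurable_funB.
  exact: (measurableT_comp (measurable_coord i) mf).
exact: (measurableT_comp (measurable_coord i) mg).
Qed.

(** The half-space deciding the sign is kept apart from the point sent: [z = y] gives the
    nearest-point map, while a fixed [y] with varying [z] gives maps that are uniformly close. *)
Definition signed_point y z x : Rn R n := if 0 < dot x y then z else neg z.

Lemma measurable_halfspace y : measurable [set x | 0 < dot x y].
Proof.
have mlt : measurable_fun setT (fun x => 0 < dot x y).
  by apply: measurable_fun_ltr => //; exact: measurable_dot.
by rewrite -[X in measurable X]setTI; exact: (mlt measurableT [set true]).
Qed.

Lemma measurable_cball r : measurable (cball R n r).
Proof.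
have mle : measurable_fun setT (fun x : Rn R n => enorm x <= r).
  apply: measurable_fun_ler => //; apply: measurableT_comp.
    by apply: continuous_measurable_fun; exact: sqrt_continuous.
  by apply: measurable_sum => i; apply: measurable_funX; exact: measurable_coord.
by rewrite -[X in measurable X]setTI; exact: (mle measurableT [set true]).
Qed.

Lemma measurable_signed_point y z : measurable_fun setT (signed_point y z).
Proof.
by apply: measurable_fun_ifT => //; apply: measurable_fun_ltr => //;
  exact: measurable_dot.
Qed.

(** Since |x + y|^2 - |x - y|^2 = 4 x.y, choosing the farther point costs exactly 4 |x.y| more. *)
Lemma edist_nearest_sqr x y z : z = y \/ z = neg y ->
  edist x z ^+ 2 = edist x (signed_point y y x) ^+ 2
    + (if z == signed_point y y x then 0 else 4 * `|dot x y|).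
Proof.
rewrite /signed_point; have := edist_sqr_neg x y.
case: ltP => xy h [] ->.
- by rewrite eqxx addr0.
- case: eqP => [->|_]; first by rewrite addr0.
  by rewrite gtr0_norm.
- case: eqP => [e|_]; first by rewrite addr0 -e.
  by rewrite ler0_norm// h; lra.
- by rewrite eqxx addr0.
Qed.

Lemma measurable_set1_Rn y : measurable [set y].
Proof.
rewrite (_ : [set y] = \bigcap_(i in [set: 'I_n])
    ((@tnth _ _ ^~ i) @^-1` [set (tnth y i : measurableTypeR R)])).
  apply: fin_bigcap_measurable; first exact: finite_finset.
  move=> i _; rewrite -[X in measurable X]setTI.
  by apply: measurable_tnth => //; exact: measurable_set1.
apply/seteqP; split => x /=; first by move=> -> i _.
by move=> h; apply: eq_from_tnth => i; exact: h.
Qed.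

Section Brenier.
Variables (rho mu : probability (Rn R n) R) (y : Rn R n).
Hypothesis rho_ball : rho (cball R n 1) = 1%E.
Hypothesis rho_hyperplane : rho [set x | dot x y = 0] = 0%E.
Hypothesis mu_push : forall A, measurable A ->
  mu A = rho (signed_point y y @^-1` A).

Let T := signed_point y y.

Let mcost (S : Rn R n -> Rn R n) : measurable_fun setT S ->
  measurable_fun setT (fun x => (edist x (S x) ^+ 2)%:E).
Proof.
move=> mS; apply/measurable_EFinP; apply: measurable_funX.
exact: measurable_edist.
Qed.

(** [mu] gives full mass to {y, -y}, so the preimage of this pair under a transport map has full
    mass. *)
Let transport_ae S : transport_map rho mu S ->
  {ae rho, forall x, S x = y \/ S x = neg y}.
Proof.
move=> [mS Smu].
have mY : measurable ([set y] `|` [set neg y]).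
  by apply: measurableU; exact: measurable_set1_Rn.
have mSY : measurable (S @^-1` ([set y] `|` [set neg y])).
  by rewrite -[X in measurable X]setTI; exact: mS.
exists (~` (S @^-1` ([set y] `|` [set neg y]))); split => //.
  exact: measurableC.
have := Smu _ mY; rewrite mu_push// /pushforward probability_setC// => ->.
rewrite (_ : signed_point y y @^-1` _ = setT) ?probability_setT ?subee//.
apply/seteqP; split => // x _; rewrite /= /signed_point.
by case: ifP; [left|right].
Qed.

(** The truncation at 0 makes the excess non-negative everywhere, so that integrals add up without
    integrability conditions. For a transport map it changes nothing almost everywhere, [T] choosing
    the nearer point. *)
Let excess S x : R :=
  Num.max (edist x (S x) ^+ 2 - edist x (T x) ^+ 2) 0.

Let T_transport : transport_map rho mu T.
Proof.
by split; [exact: measurable_signed_point|move=> A mA; rewrite mu_push].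
Qed.

Let cost_fin : (quadratic_cost rho T < +oo)%E.
Proof.
have mB := measurable_cball 1.
(* From |a - b|^2 <= 2 (|a|^2 + |b|^2), with |x| <= 1 almost everywhere. *)
pose M : R := 2 * (1 + \sum_(i < n) (tnth y i : R) ^+ 2).
apply: (@le_lt_trans _ _ (\int[rho]_x (cst M%:E) x)%E); last first.
  by rewrite integral_cst// [X in (_ * X)%E](probability_setT rho) mule1 ltry.
apply: ae_ge0_le_integral => //.
- by move=> x _; rewrite lee_fin sqr_ge0.
- by apply: mcost; exact: measurable_signed_point.
- move=> x _; rewrite lee_fin mulr_ge0// addr_ge0// sumr_ge0// => i _.
  exact: sqr_ge0.
exists (~` cball R n 1); split; first exact: measurableC.
  by apply: etrans (probability_setC rho mB) _; rewrite rho_ball subee.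
move=> x /= /not_implyP [_] h xB; apply: h; rewrite lee_fin edist_sqr.
have x1 : \sum_(i < n) (tnth x i : R) ^+ 2 <= 1.
  have s0 : 0 <= \sum_(i < n) (tnth x i : R) ^+ 2.
    by apply: sumr_ge0 => i _; exact: sqr_ge0.
  rewrite -(sqr_sqrtr s0) -[leRHS](expr1n _ 2).
  by rewrite ler_pXn2r// nnegrE// sqrtr_ge0.
apply: (@le_trans _ _ (2 * (\sum_(i < n) (tnth x i : R) ^+ 2 +
    \sum_(i < n) (tnth y i : R) ^+ 2))); last first.
  by rewrite ler_pM2l// lerD2r.
rewrite -big_split /= mulr_sumr; apply: ler_sum => i _.
rewrite /T /signed_point; case: ifP => _; rewrite ?tnth_neg.
  by have := sqr_ge0 ((tnth x i : R) + (tnth y i : R)); nra.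
by have := sqr_ge0 ((tnth x i : R) - (tnth y i : R)); nra.
Qed.

Let excess_ge0 S x : 0 <= excess S x.
Proof. by rewrite le_max lexx orbT. Qed.

Let excessE S x : S x = y \/ S x = neg y ->
  excess S x = if S x == T x then 0 else 4 * `|dot x y|.
Proof.
move=> Sx; rewrite /excess (edist_nearest_sqr _ _ _ Sx) addrAC subrr add0r.
by apply/max_idPl; case: ifP => // _; rewrite mulr_ge0.
Qed.

Let mexcess S : measurable_fun setT S ->
  measurable_fun setT (fun x => (excess S x)%:E).
Proof.
move=> mS; apply/measurable_EFinP; apply: measurable_maxr => //.
by apply: measurable_funB; apply: measurable_funX; apply: measurable_edist => //;
  exact: measurable_signed_point.
Qed.

(** The pointwise identity holds wherever [S x] is one of the two points, that is almost everywhere;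
    optimality of [T] then follows from the sign of the excess. *)
Let cost_excess S : transport_map rho mu S ->
  quadratic_cost rho S =
    (quadratic_cost rho T + \int[rho]_x (excess S x)%:E)%E.
Proof.
move=> hS; have [mS _] := hS.
have mT : measurable_fun setT T by exact: measurable_signed_point.
rewrite /quadratic_cost -ge0_integralD//; last 4 first.
- by move=> x _; rewrite lee_fin sqr_ge0.
- exact: mcost.
- by move=> x _; rewrite lee_fin.
- exact: mexcess.
apply: ae_eq_integral => //; first exact: mcost.
  apply: emeasurable_funD; first exact: mcost.
  exact: mexcess.
have := transport_ae _ hS; apply: filterS => x Sx _.
by rewrite -EFinD (excessE _ _ Sx) -edist_nearest_sqr.
Qed.

(* Both points are at the same distance from the origin, so the optimal map
   sends each point to the nearer of the two, whatever the masses. *)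
Lemma brenier_two_point : brenier_map rho mu T.
Proof.
split; first split => // S hS.
  rewrite (cost_excess _ hS) leeDl//; apply: integral_ge0 => x _.
  by rewrite lee_fin.
move=> S [hS /(_ _ T_transport)]; rewrite (cost_excess _ hS) => le_cost.
(* The cost of [T], being finite, cancels: the excess of an optimal [S] integrates to 0, hence
   vanishes almost everywhere. Off the hyperplane this forces [S x = T x]. *)
have int0 : (\int[rho]_x `|(excess S x)%:E| = 0)%E.
  under eq_integral do rewrite gee0_abs ?lee_fin//.
  apply/eqP; rewrite eq_le; apply/andP; split; last first.
    by apply: integral_ge0 => x _; rewrite lee_fin.
  rewrite -(@leeD2lE _ (quadratic_cost rho T)) ?adde0//.
  rewrite ge0_fin_numE//; apply: integral_ge0 => x _.
  by rewrite lee_fin sqr_ge0.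
have [mS _] := hS.
have /ae_eq_integral_abs ex_ae := int0.
have dot_ae : {ae rho, forall x, dot x y != 0}.
  exists [set x | dot x y = 0]; split => //.
    rewrite -[X in measurable X]setTI.
    by apply: (measurable_dot y measurableT [set 0]); exact: measurable_set1.
  by move=> x /= /negP; rewrite negbK => /eqP.
have := ex_ae measurableT (mexcess _ mS).
move: dot_ae (transport_ae _ hS); apply: filterS3 => x xy Sx /(_ I) /= /eqP.
rewrite (excessE _ _ Sx) eqe; case: (S x =P T x) => //= _.
by rewrite mulf_eq0 normr_eq0 (negbTE xy) orbF pnatr_eq0.
Qed.

End Brenier.
End TwoPointTransport.

(** * Bounds on both distances, and laws symmetric about the origin *)

Section Distances.
Context {R : realType} {n : nat}.
Implicit Types (y z : Rn R n) (rho mu nu : probability (Rn R n) R).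
Implicit Types S T : Rn R n -> Rn R n.

(** The law of [(S x, T x)] under [rho] is a coupling of cost at most [e] to the power [p]. *)
Lemma wasserstein_le_pushforward (p e : R) rho mu nu S T :
  0 < p -> 0 <= e -> measurable_fun setT S -> measurable_fun setT T ->
  (forall A, measurable A -> mu A = rho (S @^-1` A)) ->
  (forall A, measurable A -> nu A = rho (T @^-1` A)) ->
  (forall x, edist (S x) (T x) <= e) ->
  (wasserstein p mu nu <= e%:E)%E.
Proof.
move=> p0 e0 mS mT muE nuE ST.
have mST : measurable_fun setT (fun x => (S x, T x)).
  exact: measurable_fun_pair.
pose ST' : {mfun Rn R n >-> (Rn R n * Rn R n)%type} :=
  HB.pack (fun x => (S x, T x)) (isMeasurableFun.Build _ _ _ _ _ mST).
pose g : probability (Rn R n * Rn R n)%type R := distribution rho ST'.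
have gc : coupling mu nu g by split=> A mA; [rewrite muE|rewrite nuE].
have cost_le :
    (\int[g]_z ((edist z.1 z.2) `^ p)%:E <= (e `^ p)%:E)%E.
  apply: (@le_trans _ _ (\int[g]_z (cst (e `^ p)%:E) z)%E); last first.
    by rewrite integral_cst// [X in (_ * X)%E](probability_setT g) mule1.
  rewrite !ge0_integral_distribution//; last 3 first.
  - by move=> z; rewrite lee_fin powR_ge0.
  - apply/measurable_EFinP; apply: (measurableT_comp (measurable_powR p)).
    by apply: measurable_edist; [exact: measurable_fst|exact: measurable_snd].
  - by move=> z; rewrite lee_fin powR_ge0.
  apply: ge0_le_integral => //.
  - by move=> z _; rewrite lee_fin powR_ge0.
  - apply/measurable_EFinP; apply: (measurableT_comp (measurable_powR p)).
    exact: measurable_edist.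
  - move=> x _; rewrite lee_fin ge0_ler_powR ?nnegrE ?edist_ge0 ?(ltW p0)//.
    exact: ST.
apply: (@le_trans _ _ ((e `^ p)%:E `^ p^-1)%E); last first.
  by rewrite poweR_EFin -powRrM mulfV ?gt_eqF// powRr1.
apply: gt0_ler_poweR; rewrite ?invr_ge0 ?(ltW p0)//.
- rewrite in_itv /= leey andbT; apply: le_ereal_inf_tmp => _ [g' _ <-].
  by apply: integral_ge0 => z _; rewrite lee_fin powR_ge0.
- by rewrite in_itv /= leey andbT lee_fin powR_ge0.
apply: le_trans cost_le; apply: ereal_inf_lbound.
by exists g.
Qed.

(** Chebyshev's inequality: only the part of the integral over [B] is kept. *)
Lemma L2dist_ge rho S T B (e : R) : measurable B -> 0 <= e ->
  measurable_fun setT S -> measurable_fun setT T ->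
  (forall x, B x -> e <= edist (S x) (T x)) ->
  (((e ^+ 2)%:E * rho B) `^ 2^-1 <= L2dist rho S T)%E.
Proof.
move=> mB e0 mS mT eST.
have intE : (\int[rho]_x (`|(edist (S x) (T x))%:E| `^ 2) =
             \int[rho]_x (edist (S x) (T x) ^+ 2)%:E)%E.
  apply: eq_integral => x _; rewrite gee0_abs ?lee_fin ?edist_ge0//.
  by rewrite poweR_EFin powR_mulrn// edist_ge0.
have mI : measurable_fun setT (fun x => (edist (S x) (T x) ^+ 2)%:E).
  apply/measurable_EFinP; apply: measurable_funX.
  exact: measurable_edist.
rewrite /L2dist unlock /= intE; apply: gt0_ler_poweR => //.
- by rewrite in_itv /= leey andbT mule_ge0// lee_fin sqr_ge0.
- rewrite in_itv /= leey andbT; apply: integral_ge0 => x _.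
  by rewrite lee_fin sqr_ge0.
rewrite -integral_cst//.
apply: (@le_trans _ _ (\int[rho]_(x in B) (edist (S x) (T x) ^+ 2)%:E)%E).
  apply: ge0_le_integral => //.
  - by move=> x _; rewrite lee_fin sqr_ge0.
  - exact: measurable_funTS.
  - by move=> x Bx; rewrite lee_fin ler_pXn2r// ?nnegrE ?edist_ge0// eST.
apply: ge0_subset_integral => //.
by move=> x _; rewrite lee_fin sqr_ge0.
Qed.

Section Symmetric.
Variable rho : probability (Rn R n) R.
Hypothesis rhoN : forall A, measurable A -> rho (neg @^-1` A) = rho A.

(** The reflection exchanges the open half-space with its complement, up to the null hyperplane. *)
Lemma halfspace_mass y : rho [set x | dot x y = 0] = 0%E ->
  rho [set x | 0 < dot x y] = (2^-1)%:E.
Proof.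
move=> y0; set H := [set x | _].
have mH : measurable H by exact: measurable_halfspace.
have mZ : measurable [set x : Rn R n | dot x y = 0].
  rewrite -[X in measurable X]setTI.
  by apply: (measurable_dot y measurableT [set 0]); exact: measurable_set1.
have mN : measurable (neg @^-1` H).
  by rewrite -[X in measurable X]setTI; exact: measurable_neg.
have HC : ~` H = (neg @^-1` H) `|` [set x | dot x y = 0].
  apply/seteqP; split => x; rewrite /H /= ?dotNl ?oppr_gt0.
    move/negP; rewrite -leNgt le_eqVlt => /orP[/eqP|]; by [right|left].
  case=> [x0|->]; last by rewrite ltxx.
  by apply/negP; rewrite -leNgt ltW.
have HCE : rho (~` H) = (rho (neg @^-1` H) + rho [set x | dot x y = 0%R])%E.
  rewrite HC; apply: measureU => //.
  apply/seteqP; split => // x []; rewrite /H /= dotNl oppr_gt0 => + x0.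
  by rewrite x0 ltxx.
have := probability_setC rho mH; rewrite HCE y0 adde0 rhoN//.
have := fin_num_measure rho _ mH; move: (rho H) => [] //= r _.
by rewrite -EFinB => -[] rE; congr EFin; lra.
Qed.

(** Every half-space bounded by a null hyperplane has mass 1/2, so the law depends on [z] only. This
    allows the same target to be reached by cutting along another hyperplane. *)
Lemma signed_point_law y y' z A :
  rho [set x | dot x y = 0] = 0%E -> rho [set x | dot x y' = 0] = 0%E ->
  rho (signed_point y z @^-1` A) = rho (signed_point y' z @^-1` A).
Proof.
move=> h h'; have := halfspace_mass _ h; have := halfspace_mass _ h'.
have preE u : signed_point u z @^-1` A =
    if z \in A then if neg z \in A then setT else [set x | 0 < dot x u]
    else if neg z \in A then ~` [set x | 0 < dot x u] else set0.
  have [zA|zA] := boolP (z \in A); have [NzA|NzA] := boolP (neg z \in A);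
  move: zA NzA; rewrite ?inE ?notin_setE => zA NzA;
  apply/seteqP; split => x; rewrite /signed_point /=;
  by case: (0 < dot x u).
rewrite !preE => hy' hy; do 2 case: ifP => _ //; first by rewrite hy hy'.
by rewrite !probability_setC ?hy ?hy'//; exact: measurable_halfspace.
Qed.

End Symmetric.
End Distances.

(** * Densities built as a series of weighted indicators *)

Section ConcentratedDensity.
Context {disp : measure_display} {T : measurableType disp} {R : realType}.
Variables (mu : {measure set T -> \bar R}) (B : set T) (E : nat -> set T).
Variable w : nat -> R.
Hypothesis mB : measurable B.
Hypothesis mE : forall k, measurable (E k).
Hypothesis w0 : forall k, 0 <= w k.

(* [fine] sends the points where the series diverges, a null set, to 0. *)
Definition weight (x : T) : R :=
  \1_B x + fine (\sum_(k <oo) (w k * \1_(E k) x)%:E)%E.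

Lemma weight_ge_indic x : \1_B x <= weight x.
Proof.
rewrite /weight lerDl fine_ge0//; apply: nneseries_ge0 => k _ _.
by rewrite lee_fin mulr_ge0.
Qed.

Lemma weight_ge0 x : 0 <= weight x.
Proof. by apply: le_trans (weight_ge_indic x); rewrite indicE. Qed.

Lemma weight_out x : (forall k, E k `<=` B) -> ~ B x -> weight x = 0.
Proof.
move=> EB Bx; rewrite /weight indicE memNset// add0r eseries0// => k _ _.
by rewrite indicE memNset ?mulr0// => /EB.
Qed.

Lemma weight_invariant (s : T -> T) x :
  (B (s x) <-> B x) -> (forall k, E k (s x) <-> E k x) ->
  weight (s x) = weight x.
Proof.
have indic_iff (A : set T) : (A (s x) <-> A x) -> \1_A (s x) = \1_A x :> R.
  by move=> Asx; rewrite !indicE; congr (_%:R); congr nat_of_bool;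
    apply/idP/idP; rewrite !inE => /Asx.
move=> Bs Es; rewrite /weight (indic_iff _ Bs); congr (_ + fine _).
by apply: eq_eseriesr => k _; rewrite (indic_iff _ (Es k)).
Qed.

Let S x : \bar R := (\sum_(k <oo) (w k * \1_(E k) x)%:E)%E.

Let mS1 k : measurable_fun setT (fun x => (w k * \1_(E k) x)%:E).
Proof. by apply/measurable_EFinP; apply: measurable_funM. Qed.

Let S1_ge0 k x : (0 <= (w k * \1_(E k) x)%:E)%E.
Proof. by rewrite lee_fin mulr_ge0. Qed.

Let mS : measurable_fun setT S.
Proof.
rewrite (_ : S = fun x =>
    (\sum_(k <oo | k \in predT) (w k * \1_(E k) x)%:E)%E).
  by apply: ge0_emeasurable_sum => // k x _ _; exact: S1_ge0.
by apply/funext => x; apply: eq_eseriesl.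
Qed.

Let S_ge0 x : (0 <= S x)%E.
Proof. by apply: nneseries_ge0. Qed.

Lemma measurable_weight : measurable_fun setT weight.
Proof.
apply: measurable_funD; first exact: measurable_indic.
exact: (measurableT_comp (@fine_measurable R setT measurableT) mS).
Qed.

Let mweight A : measurable_fun A (fun x => (weight x)%:E).
Proof.
by apply: measurable_funTS; apply/measurable_EFinP; exact: measurable_weight.
Qed.

Hypothesis B_fin : (mu B < +oo)%E.
Hypothesis S_fin : (\sum_(k <oo) (w k)%:E * mu (E k) < +oo)%E.

Let integral_S : (\int[mu]_x S x = \sum_(k <oo) (w k)%:E * mu (E k))%E.
Proof.
rewrite integral_nneseries//; apply: eq_eseriesr => k _.
under eq_integral do rewrite EFinM.
rewrite ge0_integralZl ?lee_fin ?integral_indic ?setIT//.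
by apply/measurable_EFinP; exact: measurable_indic.
Qed.

(** The series has finite integral, hence is finite almost everywhere, and integrals do not see the
    effect of [fine]. *)
Let integral_weightE A : measurable A ->
  (\int[mu]_(x in A) (weight x)%:E = mu (B `&` A) + \int[mu]_(x in A) S x)%E.
Proof.
move=> mA.
have intS : mu.-integrable setT S.
  apply/integrableP; split => //.
  by under eq_integral do rewrite gee0_abs//; rewrite integral_S.
rewrite -integral_indic// -ge0_integralD//; last 2 first.
- by apply/measurable_EFinP; exact: measurable_indic.
- exact: measurable_funTS.
apply: ae_eq_integral => //.
  apply: emeasurable_funD; last exact: measurable_funTS.
  by apply/measurable_EFinP; exact: measurable_indic.
have := integrable_ae measurableT intS.
apply: filterS => x /(_ I) Sfin _.
by rewrite /weight EFinD fineK.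
Qed.

Lemma integral_weight_lty : (\int[mu]_x (weight x)%:E < +oo)%E.
Proof. by rewrite integral_weightE// setIT integral_S lte_add_pinfty. Qed.

(** All terms being non-negative, the k-th one alone gives a lower bound. *)
Lemma integral_weight_ge k A : measurable A ->
  ((w k)%:E * mu (E k `&` A) <= \int[mu]_(x in A) (weight x)%:E)%E.
Proof.
move=> mA; rewrite integral_weightE//.
apply: (@le_trans _ _ (\int[mu]_(x in A) S x)%E); last first.
  by rewrite leeDr.
rewrite -integral_indic// -ge0_integralZl ?lee_fin//.
- apply: ge0_le_integral => //.
  + by move=> x _; rewrite mule_ge0// lee_fin.
  + apply: measurable_funeM; apply/measurable_EFinP.
    exact: measurable_indic.
  + exact: measurable_funTS.
  + move=> x _; rewrite -EFinM /S (@nneseriesD1 _ _ k)//.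
    by rewrite leeDl// nneseries_ge0.
- by apply/measurable_EFinP; exact: measurable_indic.
Qed.

End ConcentratedDensity.

(** * Volumes of closed boxes, and integrals under reflection *)

Section ClosedBoxes.
Context {R : realType} {n : nat}.

Definition cbox (u v : 'I_n -> R) : set (Rn R n) :=
  [set x | forall i, u i <= (tnth x i : R) <= v i].

Lemma measurable_cbox u v : measurable (cbox u v).
Proof.
rewrite (_ : cbox u v = \bigcap_(i in [set: 'I_n])
    ((@tnth _ _ ^~ i) @^-1` [set` `[u i, v i]])).
  apply: fin_bigcap_measurable; first exact: finite_finset.
  move=> i _; rewrite -[X in measurable X]setTI.
  by apply: measurable_tnth => //; exact: measurable_itv.
apply/seteqP; split => x /= h i; first by move=> _; rewrite ?in_itv /=; exact: h.
by have := h i I; rewrite /= ?in_itv.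
Qed.

Lemma lebesgue_cbox u v : (forall i, u i <= v i) ->
  lebesgue R n (cbox u v) = (\prod_(i < n) (v i - u i))%:E.
Proof.
move=> uv.
pose A i : set (measurableTypeR R) := [set` `[u i, v i]].
have -> : cbox u v = [set x | forall i, A i (tnth x i)].
  apply/funext => x; apply/propext; rewrite /A.
  by split=> h i; have := h i; rewrite /= in_itv.
rewrite lebesgue_box; last by move=> i; exact: measurable_itv.
have lE i : lebesgue_measure (A i) = (v i - u i)%:E.
  rewrite /A lebesgue_measure_itv /= lte_fin; case: ltP => // vu.
  by rewrite (le_anti (_ : v i <= u i <= v i)) ?subrr// vu uv.
rewrite (eq_bigr _ (fun i _ => lE i)).
by rewrite (big_morph EFin (@EFinM R) erefl).
Qed.

End ClosedBoxes.

Lemma integral_lebesgueN {R : realType} {n} (A : set (Rn R n))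
    (g : Rn R n -> \bar R) :
  measurable A -> measurable_fun A g -> (forall x, (0 <= g x)%E) ->
  (\int[lebesgue R n]_(x in neg @^-1` A) (g \o neg) x =
   \int[lebesgue R n]_(x in A) g x)%E.
Proof.
move=> mA mg g0.
rewrite -(@ge0_integral_pushforward _ _ _ _ _ _ measurable_neg)//.
apply: eq_measure_integral => [|mN C mC _]; first exact: measurable_neg.
exact: lebesgueN.
Qed.

(** * A symmetric probability measure with heavy thin slabs *)

Section ConcentratedProbability.
Context {R : realType} {n : nat}.
Local Notation dim := (n.+2%:R : R).
Local Notation ball := (cball R n.+2 1).

Lemma neg_cball (x : Rn R n.+2) r : cball R n.+2 r (neg x) <-> cball R n.+2 r x.
Proof.
rewrite /cball /= (_ : enorm (neg x) = enorm x)//; congr Num.sqrt.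
by apply: eq_bigr => i _; rewrite tnth_neg sqrrN.
Qed.

Lemma coord_le_enorm (x : Rn R n.+2) i : `|tnth x i : R| <= enorm x.
Proof.
rewrite -sqrtr_sqr ler_wsqrtr// (bigD1 i)//= lerDl sumr_ge0// => j _.
exact: sqr_ge0.
Qed.

Definition width k : R := 2^-1 ^+ (k * k).

Lemma width_gt0 k : 0 < width k.
Proof. by rewrite exprn_gt0// invr_gt0. Qed.

Lemma width_le1 k : width k <= 1.
Proof. by rewrite exprn_ile1 ?invr_ge0// invf_le1// ler1n. Qed.

Definition slab k : set (Rn R n.+2) :=
  [set x | ball x /\ `|tnth x ord0 : R| <= width k].

(* Slab number k receives a mass of order 2^-k, which is larger than any power
   of its width 2^-(k^2). *)
Definition slab_weight k : R := 1 / (2 ^ k.+1)%:R / width k.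

(** A part of slab k with comparable volume. The first coordinate is positive of order [width k] and
    the others are negative and bounded away from 0, so a small tilt of the hyperplane x_0 = 0
    sweeps across the whole box; the factor 1/d keeps it in the unit ball. *)
Definition thin_box k : set (Rn R n.+2) :=
  cbox (fun i => if i == ord0 then width k / (2 * dim) else - dim^-1)
       (fun i => if i == ord0 then width k / dim else - (2 * dim)^-1).

Lemma measurable_slab k : measurable (slab k).
Proof.
rewrite (_ : slab k = ball `&` [set x | `|tnth x ord0 : R| <= width k])//.
apply: measurableI; first exact: measurable_cball.
have mle : measurable_fun setT
    (fun x : Rn R n.+2 => `|tnth x ord0 : R| <= width k).
  apply: measurable_fun_ler => //; apply: measurableT_comp => //.
  exact: measurable_coord.
by rewrite -[X in measurable X]setTI; exact: (mle measurableT [set true]).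
Qed.

Lemma slab_weight_ge0 k : 0 <= slab_weight k.
Proof. by rewrite !divr_ge0// ltW// width_gt0. Qed.

(** The slab lies in a box of half-side [width k] along the first axis and 1 along the others. *)
Lemma lebesgue_slab k :
  (lebesgue R n.+2 (slab k) <= (2 ^+ n.+2 * width k)%:E)%E.
Proof.
pose v (i : 'I_n.+2) : R := if i == ord0 then width k else 1.
have v0 i : 0 <= v i by rewrite /v; case: ifP => // _; exact/ltW/width_gt0.
apply: (@le_trans _ _ (lebesgue R n.+2 (cbox (fun i => - v i) v))).
  apply: le_measure; rewrite ?inE; [exact: measurable_slab| |].
    exact: measurable_cbox.
  move=> x [xB x0] i; rewrite -ler_norml /v; case: eqP => [->//|_].
  exact: le_trans (coord_le_enorm x i) xB.
rewrite lebesgue_cbox; last by move=> i; rewrite ge0_cp.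
rewrite lee_fin big_ord_recl /v /= opprK.
under eq_bigr do rewrite opprK.
rewrite prodr_const card_ord !exprS -[1 + 1]/(2 : R).
by set X := 2 ^+ n; rewrite le_eqVlt; apply/orP; left; apply/eqP; ring.
Qed.

Lemma lebesgue_ball_lty : (lebesgue R n.+2 ball < +oo)%E.
Proof.
(* Slab 0 has width 1, so it is the whole ball. *)
apply: (@le_lt_trans _ _ (lebesgue R n.+2 (slab 0))).
  apply: le_measure; rewrite ?inE; [exact: measurable_cball| |].
    exact: measurable_slab.
  move=> x xB; split => //; rewrite /width expr0.
  exact: le_trans (coord_le_enorm x ord0) xB.
exact: le_lt_trans (lebesgue_slab 0) (ltry _).
Qed.

Lemma thin_box_slab k : thin_box k `<=` slab k.
Proof.
have d0 : 0 < dim by rewrite ltr0n.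
have w0 := width_gt0 k; have w1 := width_le1 k.
have id0 : 0 < dim^-1 by rewrite invr_gt0.
have id1 : dim^-1 <= 1 by rewrite invf_le1// ler1n.
have q0 : 0 <= width k / (2 * dim) by rewrite divr_ge0 ?ltW// mulr_gt0.
have qd : width k / dim <= dim^-1 by rewrite ler_piMl// ltW.
have qw : width k / dim <= width k by rewrite ler_piMr// ltW.
have d2 : - (2 * dim)^-1 <= dim^-1.
  by apply: (@le_trans _ _ 0); [rewrite oppr_le0 invr_ge0 mulr_ge0|exact: ltW].
move=> x xk.
have xi i : `|tnth x i : R| <= dim^-1.
  have := xk i; case: ifP => _ /andP[l u]; rewrite ler_norml.
    by rewrite (le_trans u)// andbT (le_trans _ l)// (le_trans _ q0)//
      oppr_le0 ltW.
  by rewrite l /= (le_trans u).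
split; last first.
  have := xk ord0; rewrite eqxx => /andP[l u].
  by rewrite ler_norml (le_trans u)// andbT (le_trans _ l)// (le_trans _ q0)//
    oppr_le0 ltW.
rewrite /cball /= /enorm -[leRHS]sqrtr1 ler_wsqrtr//.
(* Each of the d squares is at most 1/d^2 <= 1/d, so they add up to at most 1. *)
apply: (@le_trans _ _ (\sum_(i < n.+2) dim^-1)).
  apply: ler_sum => i _; rewrite -real_normK ?num_real//.
  apply: (@le_trans _ _ (dim^-1 ^+ 2)); last by rewrite ler_piMr// ltW.
  by rewrite ler_pXn2r ?nnegrE ?(ltW id0).
by rewrite sumr_const card_ord -[leLHS]mulr_natr mulVf// gt_eqF.
Qed.

Lemma lebesgue_thin_box k :
  lebesgue R n.+2 (thin_box k) = ((2 * dim)^-1 ^+ n.+2 * width k)%:E.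
Proof.
have d0 : 0 < dim by rewrite ltr0n.
have w0 := width_gt0 k.
have id0 : 0 < dim^-1 by rewrite invr_gt0.
rewrite lebesgue_cbox; last first.
  move=> i; case: ifP => _; rewrite invfM.
    by rewrite ler_pM2l// ler_piMl ?(ltW id0)// invf_le1// ler1n.
  by rewrite lerN2 ler_piMl ?(ltW id0)// invf_le1// ler1n.
congr EFin; rewrite big_ord_recl /= exprS.
rewrite (eq_bigr (fun=> (2 * dim)^-1)); last by move=> i _; rewrite invfM; field.
rewrite prodr_const card_ord; set X := _ ^+ n.+1.
by rewrite invfM; field; rewrite gt_eqF.
Qed.

(** The density is the normalised weight: the indicator of the ball bounds it below, the symmetry of
    ball and slabs makes it even, and slab k alone accounts for the mass claimed on [thin_box k]. *)
Lemma exists_concentrated_probability :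
  exists (rho : probability (Rn R n.+2) R) (f : Rn R n.+2 -> R) (c kappa : R),
  [/\ rho ball = 1%E, has_density rho f, 0 < c /\ forall x, ball x -> c <= f x,
      forall A, measurable A -> rho (neg @^-1` A) = rho A &
      0 < kappa /\ forall k, ((kappa / 2 ^+ k)%:E <= rho (thin_box k))%E].
Proof.
have mB : measurable ball by exact: measurable_cball.
have mE := measurable_slab; have w0 := slab_weight_ge0.
have EB k : slab k `<=` ball by move=> x [].
pose h := weight ball slab slab_weight.
have mh : measurable_fun setT h by exact: measurable_weight.
(* The width cancels: term k is at most 2^(n+2) / 2^(k+1), which is a geometric series. *)
have S_fin : (\sum_(k <oo) (slab_weight k)%:E * lebesgue R n.+2 (slab k) < +oo)%E.
  apply: (@le_lt_trans _ _
      (\sum_(k <oo) (2 ^+ n.+2 / (2 ^ k.+1)%:R)%:E)%E); last first.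
    apply: le_lt_trans (ltry (2 ^+ n.+2)); apply: epsilon_trick0.
    exact: exprn_ge0.
  apply: lee_nneseries => k _; first by rewrite mule_ge0// lee_fin.
  apply: le_trans (_ : (_ * (2 ^+ n.+2 * width k)%:E <= _)%E).
    by apply: lee_wpmul2l; [rewrite lee_fin|exact: lebesgue_slab].
  have e0 : (0 : R) < (2 ^ k.+1)%:R by rewrite ltr0n expn_gt0.
  have wk := width_gt0 k; rewrite -EFinM lee_fin /slab_weight.
  move: e0; set e := (2 ^ k.+1)%:R; set c := 2 ^+ n.+2 => e0.
  by rewrite le_eqVlt; apply/orP; left; apply/eqP; field; rewrite !gt_eqF.
have hfin := integral_weight_lty _ _ _ _ mB mE w0 lebesgue_ball_lty S_fin.
have hge := integral_weight_ge _ _ _ _ mB mE w0 S_fin.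
pose I := (\int[lebesgue R n.+2]_x (h x)%:E)%E.
have h0 x : 0 <= h x by exact: weight_ge0.
have I_ge0 : (0 <= I)%E by apply: integral_ge0 => x _; rewrite lee_fin.
pose Z := fine I.
have IE : I = Z%:E by rewrite /Z fineK// ge0_fin_numE.
have Z0 : 0 < Z.
  rewrite -lte_fin -IE; apply: lt_le_trans (hge 0%N setT measurableT).
  rewrite setIT mule_gt0//.
    by rewrite lte_fin !divr_gt0// ?width_gt0// ltr0n expn_gt0.
  apply: (@lt_le_trans _ _ (lebesgue R n.+2 (thin_box 0))).
    by rewrite lebesgue_thin_box lte_fin mulr_gt0 ?width_gt0.
  apply: le_measure; rewrite ?inE; [exact: measurable_cbox|exact: mE|].
  exact: thin_box_slab.
pose f x := Z^-1 * h x.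
have Zi0 : 0 < Z^-1 by rewrite invr_gt0.
have mf : measurable_fun setT f by exact: measurable_funM.
have f0 x : 0 <= f x by rewrite mulr_ge0// ltW.
have fintE A : measurable A ->
    (\int[lebesgue R n.+2]_(x in A) (f x)%:E =
     Z^-1%:E * \int[lebesgue R n.+2]_(x in A) (h x)%:E)%E.
  move=> mA; rewrite -ge0_integralZl ?lee_fin ?(ltW Zi0)//.
    by apply: measurable_funTS; exact/measurable_EFinP.
  by move=> x _; rewrite lee_fin.
have f1 : (\int[lebesgue R n.+2]_x (f x)%:E = 1)%E.
  by rewrite fintE// -/I IE -EFinM mulVf// gt_eqF.
have [rho rhoE] := probability_of_density (lebesgue R n.+2) f mf f0 f1.
(* [slab_weight k] times the volume of [thin_box k], divided by [Z], is [kappa / 2 ^+ k]; the factor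
   1/2 comes from the exponent [k.+1] in the weight. *)
pose kappa := Z^-1 * (2^-1 * (2 * dim)^-1 ^+ n.+2).
exists rho, f, Z^-1, kappa; split.
- have out x : ~ ball x -> f x = 0 by move=> xB; rewrite /f /h weight_out// mulr0.
  rewrite rhoE// integral_mkcond -[RHS]f1; apply: eq_integral => x _.
  rewrite patchE; case: ifPn => //; rewrite notin_setE => xB.
  by rewrite out.
- by split.
- split => // x xB; rewrite /f ler_peMr ?(ltW Zi0)//.
  have := weight_ge_indic ball slab _ w0 x.
  by rewrite indicE mem_set.
- move=> A mA.
  have mN : measurable (neg @^-1` A).
    by rewrite -[X in measurable X]setTI; exact: measurable_neg.
  rewrite !rhoE//.
  transitivity (\int[lebesgue R n.+2]_(x in neg @^-1` A)
      ((EFin \o f) \o neg) x)%E.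
    apply: eq_integral => x _ /=; congr EFin; rewrite /f; congr (_ * _).
    apply/esym/weight_invariant; first exact: neg_cball.
    by move=> k; rewrite /slab /= neg_cball tnth_neg normrN.
  apply: integral_lebesgueN => //.
  by apply: measurable_funTS; exact/measurable_EFinP.
- split=> [|k].
    by rewrite /kappa mulr_gt0// mulr_gt0.
  have mt : measurable (thin_box k) by exact: measurable_cbox.
  rewrite rhoE// fintE//.
  apply: (@le_trans _ _ (Z^-1%:E * ((slab_weight k)%:E *
      lebesgue R n.+2 (slab k `&` thin_box k)))%E); last first.
    by apply: lee_wpmul2l; [rewrite lee_fin ltW|exact: hge].
  have -> : slab k `&` thin_box k = thin_box k.
    by apply/setIidPr; exact: thin_box_slab.
  rewrite lebesgue_thin_box -!EFinM lee_fin /kappa /slab_weight natrX (exprS _ k).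
  set X := _ ^+ n.+2; have w := width_gt0 k.
  have p : (0 : R) < 2 ^+ k by rewrite exprn_gt0.
  by rewrite le_eqVlt; apply/orP; left; apply/eqP; field; rewrite !gt_eqF.
Qed.

End ConcentratedProbability.

(** * Absolute continuity, and slab widths against slab masses *)

Lemma density_dominated {R : realType} {n} (rho : probability (Rn R n) R) f :
  has_density rho f -> rho `<< lebesgue R n.
Proof.
move=> [mf f0 rhoE]; apply/null_content_dominatesP => A mA A0.
rewrite rhoE//; apply: null_set_integral => //.
by apply: measurable_funTS; exact/measurable_EFinP.
Qed.

(** The quadratic exponent wins: 2^-(alpha k^2) <= 2^-k as soon as alpha k >= 1, and M 2^-k <
    2^-(k/2) as soon as M^2 < 2^k. *)
Lemma exists_width_lt {R : realType} (alpha M : R) : 0 < alpha -> 0 <= M ->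
  exists k, M * width k `^ alpha < Num.sqrt (2^-1 ^+ k).
Proof.
(* A single k beyond both 1/alpha and M^2 meets the two conditions, because k < 2^k. *)
move=> a0 M0; pose k := Num.bound (alpha^-1 + M ^+ 2).
have ai0 : 0 < alpha^-1 by rewrite invr_gt0.
have M2 := sqr_ge0 M.
have kgt : alpha^-1 + M ^+ 2 < k%:R by apply: archi_boundP; lra.
have t0 : (0 : R) < 2^-1 ^+ k by rewrite exprn_gt0// invr_gt0.
have kM : M ^+ 2 * 2^-1 ^+ k < 1.
  rewrite exprVn ltr_pdivrMr ?exprn_gt0// mul1r.
  apply: lt_trans (_ : k%:R < _); first lra.
  by rewrite -natrX ltr_nat ltn_expl.
have wk : width k `^ alpha <= (2^-1 ^+ k : R).
  rewrite /width -!powR_mulrn ?invr_ge0// -powRrM.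
  apply: ger_powR; first by rewrite invr_gt0 ltr0n /= invf_le1// ler1n.
  have k1 : alpha^-1 <= k%:R by lra.
  rewrite natrM -mulrA ler_peMr//.
  by rewrite -[leLHS](mulVf (lt0r_neq0 a0)) ler_pM2r.
exists k; apply: le_lt_trans (ler_wpM2l M0 wk) _.
rewrite -[ltLHS]ger0_norm ?mulr_ge0 ?(ltW t0)// -sqrtr_sqr ltr_sqrt//.
by rewrite exprMn expr2 mulrA gtr_pMl.
Qed.

(** * Two targets differing by a small tilt *)

Section TiltedPoints.
Context {R : realType} {n : nat}.

(** The tilt takes place in the plane of the first two axes, available because d >= 2. *)
Definition planar (u v : R) : Rn R n.+2 :=
  [tuple of u :: v :: nseq n 0].

Let sum_planar (F : 'I_n.+2 -> R) :
  (forall i, F (lift ord0 (lift ord0 i)) = 0) ->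
  \sum_(i < n.+2) F i = F ord0 + F (lift ord0 ord0).
Proof.
move=> F0; rewrite !big_ord_recl big1 ?addr0// => i _.
Qed.

Let tnth_planar2 u v (i : 'I_n) :
  tnth (planar u v) (lift ord0 (lift ord0 i)) = 0 :> R.
Proof. by rewrite !tnthS (tnth_nth 0) /= nth_nseq if_same. Qed.

Lemma dot_planar x u v :
  dot x (planar u v) = (tnth x ord0 : R) * u + (tnth x (lift ord0 ord0) : R) * v.
Proof. by rewrite /dot sum_planar// => i; rewrite tnth_planar2 mulr0. Qed.

Lemma enorm_planar u v : enorm (planar u v) = Num.sqrt (u ^+ 2 + v ^+ 2).
Proof.
by rewrite /enorm sum_planar// => i; rewrite tnth_planar2 expr0n.
Qed.

Lemma edist_planar u v u' v' : edist (planar u v) (planar u' v') =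
  Num.sqrt ((u - u') ^+ 2 + (v - v') ^+ 2).
Proof.
by rewrite /edist sum_planar// => i; rewrite !tnth_planar2 subrr expr0n.
Qed.

Lemma neg_planar u v : neg (planar u v) = planar (- u) (- v).
Proof.
apply: eq_from_tnth => i; rewrite tnth_neg.
case: (unliftP ord0 i) => [j|] -> //; rewrite !tnthS.
case: (unliftP ord0 j) => [l|] -> //.
by rewrite !(tnth_nth 0) /= !nth_nseq !if_same oppr0.
Qed.

Variable rho : probability (Rn R n.+2) R.
Hypothesis rho_ball : rho (cball R n.+2 1) = 1%E.
Hypothesis rho_ll : rho `<< lebesgue R n.+2.
Hypothesis rhoN : forall A, measurable A -> rho (neg @^-1` A) = rho A.

Let rho_hyperplane u v : 0 < u -> rho [set x | dot x (planar u v) = 0] = 0%E.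
Proof.
move=> u0; move/null_content_dominatesP : rho_ll; apply.
  rewrite -[X in measurable X]setTI.
  by apply: (measurable_dot _ measurableT [set 0]); exact: measurable_set1.
by apply: lebesgue_hyperplane; rewrite theadE gt_eqF.
Qed.

(** Defined as the image of [rho] under the intended Brenier map, so that the transport condition
    holds by construction. *)
Let law y : probability (Rn R n.+2) R :=
  distribution rho (HB.pack_for {mfun Rn R n.+2 >-> Rn R n.+2}
    (signed_point y y)
    (isMeasurableFun.Build _ _ _ _ _ (measurable_signed_point y y))).

Let lawE y A : law y A = rho (signed_point y y @^-1` A).
Proof. by []. Qed.

Let law_supported r u v : 0 <= r -> u ^+ 2 + v ^+ 2 <= r ^+ 2 ->
  supported_on (law (planar u v)) (cball R n.+2 r).
Proof.
move=> r0 uvr; rewrite /supported_on lawE (_ : _ @^-1` _ = setT).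
  exact: probability_setT.
apply/seteqP; split=> // x _; rewrite /= /signed_point /cball /=.
by case: ifP => _; rewrite ?neg_planar enorm_planar ?sqrrN -(ger0_norm r0)
  -sqrtr_sqr ler_wsqrtr.
Qed.

(** The tilt moves the target points by only [r / 2 * width k], yet it changes the sign chosen on
    [thin_box k], where one map is [y] and the other [-z]. *)
Lemma tilted_pair r p k : 0 < r -> 0 < p ->
  exists mu nu : probability (Rn R n.+2) R,
    [/\ supported_on mu (cball R n.+2 r),
        supported_on nu (cball R n.+2 r) &
        exists Tmu Tnu : Rn R n.+2 -> Rn R n.+2,
          [/\ brenier_map rho mu Tmu, brenier_map rho nu Tnu,
              (wasserstein p mu nu <= (r / 2 * width k)%:E)%E &
              (((r / 4) ^+ 2)%:E * rho (thin_box k)) `^ 2^-1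
                <= L2dist rho Tmu Tnu]]%E.
Proof.
move=> r0 p0; have w0 := @width_gt0 R k; have w1 := @width_le1 R k.
set w := width k in w0 w1 *.
have d0 : (0 : R) < n.+2%:R by rewrite ltr0n.
(* The slope [v / u = 4 * width k] is just large enough for [thin_box k] to lie
   between the hyperplanes orthogonal to [y] and [z]. *)
pose u := r / 8; pose v := r / 2 * w.
have u0 : 0 < u by rewrite divr_gt0.
have v0 : 0 <= v by rewrite mulr_ge0 ?divr_ge0 ?ltW.
pose y := planar u 0; pose z := planar u v.
have Hy : rho [set x | dot x y = 0] = 0%E by exact: rho_hyperplane.
have Hz : rho [set x | dot x z = 0] = 0%E by exact: rho_hyperplane.
exists (law y), (law z); split.
- by apply: law_supported; rewrite ?ltW// /u; nra.
- apply: law_supported; rewrite ?ltW// /u /v.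
  have : w ^+ 2 <= 1 by rewrite expr_le1// ltW.
  by have := sqr_ge0 r; nra.
exists (signed_point y y), (signed_point z z); split.
- exact: brenier_two_point.
- exact: brenier_two_point.
(* By symmetry the second target is also the image of [rho] under [signed_point y z]. This map
   switches sign on the same hyperplane as [signed_point y y], so the two are at distance |y - z| =
   v everywhere. *)
- apply: (@wasserstein_le_pushforward _ _ _ _ rho _ _ (signed_point y y)
    (signed_point y z)) => //.
  + exact: measurable_signed_point.
  + exact: measurable_signed_point.
  + by move=> A mA; rewrite lawE; exact: signed_point_law.
  + move=> x; have yz : edist y z = v.
      rewrite edist_planar subrr expr0n /= add0r sub0r sqrrN.
      by rewrite sqrtr_sqr ger0_norm.
    by rewrite /signed_point; case: ifP => _; rewrite ?edist_negneg yz.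
- apply: L2dist_ge.
  + exact: measurable_cbox.
  + by rewrite divr_ge0// ltW.
  + exact: measurable_signed_point.
  + exact: measurable_signed_point.
  move=> x xk; have := xk ord0; have := xk (lift ord0 ord0) => /=.
  set x0 : R := tnth x ord0; set x1 : R := tnth x (lift ord0 ord0).
  move=> /andP[_ x1u] /andP[x0l x0u].
  have x00 : 0 < x0.
    by apply: lt_le_trans x0l; rewrite divr_gt0// mulr_gt0.
  have -> : signed_point y y x = y.
    by rewrite /signed_point dot_planar mulr0 addr0 mulr_gt0.
  (* On the box x0 <= w/d and x1 <= -1/(2d), whence x0 + 4 w x1 <= -w/d <= 0. *)
  have -> : signed_point z z x = neg z.
    rewrite /signed_point dot_planar -/x0 -/x1 ifF//; apply/negbTE.
    rewrite -leNgt (_ : _ + _ = r / 8 * (x0 + 4 * w * x1)); last first.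
      by rewrite /u /v; field.
    rewrite pmulr_rle0//; apply: le_trans (lerD x0u (ler_wpM2l _ x1u)) _.
      by rewrite mulr_ge0// ltW.
    move: d0; set e : R := n.+2%:R => d0; rewrite -/w.
    rewrite (_ : _ + _ = - (w / e)); last by field; rewrite gt_eqF.
    by rewrite oppr_le0 divr_ge0// ltW.
  (* The first coordinates of [y] and [-z] already differ by 2u = r/4. *)
  rewrite neg_planar edist_planar.
  rewrite -[leLHS]ger0_norm ?divr_ge0 ?(ltW r0)// -sqrtr_sqr ler_wsqrtr//.
  rewrite /u; have := sqr_ge0 (0 - - v); nra.
Qed.

End TiltedPoints.

(** * Failure of every Hoelder bound *)

Theorem theorem1p1 (R : realType) (d : nat) (hd : (2 <= d)%N) :
  exists rho : probability (Rn R d) R,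
    [/\ supported_on rho (cball R d 1),
        rho `<< lebesgue R d,
        (exists (f : Rn R d -> R) (c : R),
          [/\ has_density rho f, 0 < c &
              forall x, cball R d 1 x -> c <= f x]) &
        forall r C alpha p : R,
          0 < r -> 0 < C -> 0 < alpha -> 1 <= p ->
          exists mu nu : probability (Rn R d) R,
            [/\ supported_on mu (cball R d r),
                supported_on nu (cball R d r) &
                exists Tmu Tnu : Rn R d -> Rn R d,
                  [/\ brenier_map rho mu Tmu,
                      brenier_map rho nu Tnu &
                      (C%:E * wasserstein p mu nu `^ alpha
                        < L2dist rho Tmu Tnu)%E]]].
Proof.
case: d hd => [|[|n]]// _.
have [rho [f [c [kappa [rho_ball fE [c0 cf] rhoN [kappa0 rho_box]]]]]] :=
  @exists_concentrated_probability R n.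
have rho_ll := density_dominated _ _ fE.
exists rho; split => //; first by exists f, c; split.
move=> r C alpha p r0 C0 alpha0 p1.
have p0 : 0 < p by exact: lt_le_trans p1.
have sk0 : 0 < Num.sqrt kappa by rewrite sqrtr_gt0.
have K0 : 0 < r / 4 * Num.sqrt kappa by rewrite mulr_gt0// divr_gt0.
(* [M] gathers the factors independent of k in the target inequality C (r/2 w)^alpha < (r/4)
   sqrt(kappa / 2^k), with w the width of slab k. *)
pose M := C * (r / 2) `^ alpha / (r / 4 * Num.sqrt kappa).
have M0 : 0 <= M by rewrite divr_ge0 ?mulr_ge0 ?powR_ge0// ltW.
have [k Mk] := exists_width_lt _ _ alpha0 M0.
have [mu [nu [mur nur [Tmu [Tnu [bmu bnu W L]]]]]] :=
  tilted_pair _ rho_ball rho_ll rhoN r p k r0 p0.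
exists mu, nu; split => //; exists Tmu, Tnu; split => //.
have W0 : (0 <= wasserstein p mu nu)%E by exact: poweR_ge0.
have rw0 : 0 <= r / 2 * width k by rewrite mulr_ge0 ?divr_ge0 ?ltW// width_gt0.
apply: (@le_lt_trans _ _ (C * (r / 2 * width k) `^ alpha)%:E).
  rewrite EFinM -poweR_EFin lee_wpmul2l ?lee_fin ?(ltW C0)//.
  by apply: gt0_ler_poweR; rewrite ?in_itv/= ?leey ?andbT ?lee_fin// ltW.
apply: lt_le_trans L.
apply: (@lt_le_trans _ _
    ((((r / 4) ^+ 2)%:E * (kappa / 2 ^+ k)%:E) `^ 2^-1)%E); last first.
  apply: gt0_ler_poweR => //.
  - rewrite in_itv/= leey andbT -EFinM lee_fin mulr_ge0 ?sqr_ge0//.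
    by rewrite divr_ge0// ltW.
  - by rewrite in_itv/= leey andbT mule_ge0// lee_fin sqr_ge0.
  - by apply: lee_wpmul2l (rho_box k); rewrite lee_fin sqr_ge0.
have r40 : 0 <= r / 4 by rewrite divr_ge0// ltW.
have k2 : 0 <= (r / 4) ^+ 2 * (kappa / 2 ^+ k).
  by rewrite mulr_ge0 ?sqr_ge0// divr_ge0// ltW.
rewrite -EFinM poweR_EFin lte_fin powR12_sqrt//.
rewrite sqrtrM ?sqr_ge0// sqrtr_sqr ger0_norm// sqrtrM ?(ltW kappa0)//.
rewrite powRM ?divr_ge0 ?(ltW r0) ?ltW ?width_gt0// -exprVn mulrA mulrA.
by rewrite -ltr_pdivrMl// mulrA [_^-1 * _]mulrC.
Qed.
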